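(* Let $\mathbb{D}=\{D_{\phi_i,\rho_i,e_i}\}_{i=1}^m$ be a set of root derivations of the field $K_0(M)$ ($m\ge2$, pairwise non-proportional over $K_0$), and let $r$ be the number of pairwise distinct elements of the set $\{\rho_1,\ldots,\rho_m\}$. (1) If the set $\mathbb{D}$ is almost simple, then the Lie algebra $\operatorname{Lie}_{K_0}(\mathbb{D})$ is isomorphic to $\mathfrak{sl}_r(K_0)$. (2) If the set $\mathbb{D}$ is very simple, then the Lie algebra $\operatorname{Lie}(\mathbb{D})$ is isomorphic to $\mathfrak{sl}_r(\mathbf{k})$.
   Context: $\mathbf{k}$ is an algebraically closed field of characteristic zero, $Y$ an algebraic variety over $\mathbf{k}$, $K_0=\mathbf{k}(Y)$. $M$ is a lattice of rank $n$, $N=\operatorname{Hom}(M,\mathbb{Z})$, $\langle v,u\rangle=v(u)$ the pairing $N\times M\to\mathbb{Z}$; $K_0(M)$ is the quotient field of the group algebra $K_0[M]=\bigoplus_{u\in M}K_0\chi^u$, $\chi^u\chi^{u'}=\chi^{u+u'}$. A fan $\Sigma$ in $N_{\mathbb{Q}}$ (finite collection of strictly convex rational polyhedral cones, closed under faces, any two meeting in a common face) is fixed; $\Sigma(1)$ is the set of primitive vectors in $N$ on its rays. A Demazure root of $\Sigma$ is $e\in M$ such that there is $\rho\in\Sigma(1)$ with $\langle\rho,e\rangle=-1$ and $\langle\rho',e\rangle\ge0$ for all $\rho'\in\Sigma(1)$, $\rho'\ne\rho$; $\rho$ is the ray associated with $e$. A root derivation $D_{\phi,\rho,e}$, with $\phi\in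 K_0$ and $e$ a Demazure root of $\Sigma$ with associated ray $\rho$, is the $K_0$-derivation of $K_0(M)$ given by $D_{\phi,\rho,e}(\chi^u)=\phi\,\rho(u)\,\chi^{u+e}$, $u\in M$. For a set $\mathbb{D}=\{D_{\phi_i,\rho_i,e_i}\}_{i=1}^m$ of $m\ge2$ root derivations, pairwise non-proportional over $K_0$, put $\rho_{m+1}:=\rho_1$. It is cyclic if $\langle\rho_{i+1},e_i\rangle>0$ for all $i=1,\dots,m$. It is almost simple if for all $i$ and all $\rho\in\Sigma(1)$: $\langle\rho,e_i\rangle=-1$ if $\rho=\rho_i$, $\langle\rho,e_i\rangle=1$ if $\rho=\rho_{i+1}$, and $\langle\rho,e_i\rangle=0$ if $\rho\in\Sigma(1)\setminus\{\rho_i,\rho_{i+1}\}$. An almost simple set is simple if $\prod_{i=1}^m\phi_i\in\mathbf{k}$. A subset is called cyclic (almost simple, simple) if its elements can be listed in an order for which the corresponding condition holds. A simple set is very simple if every one of its cyclic subsets is simple as well. $\operatorname{Lie}_{K_0}(\mathbb{D})$ is the Lie algebra over $K_0$ generated by $\mathbb{D}$ in the Lie algebra $\operatorname{Der}_{K_0}(K_0(M))$ of all $K_0$-derivations of $K_0(M)$; $\operatorname{Lie}(\mathbb{D})$ is the Lie algebra over $\mathbf{k}$ generated by $\mathbb{D}$ in the Lie algebra of all $\mathbf{k}$-derivations of $K_0(M)$.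
   Formalization: It is additionally assumed that the rays of Σ span N_Q; without this the claim fails, e.g. M=Z^3 with rays (1,0,0),(0,1,0), φ_1=φ_2=1, e_1=(-1,1,0), e_2=(1,-1,1), where both Lie algebras are infinite-dimensional. *)

(* Defs.v *)
From HB Require Import structures.
From mathcomp Require Import all_boot all_order all_algebra finmap.
From mathcomp Require Import boolp classical_sets functions cardinality.
From mathcomp Require Import -(notations) monalg.
From mathcomp Require Import mpoly.
From mathcomp Require Import ring.

Set Implicit Arguments.
Unset Strict Implicit.
Unset Printing Implicit Defensive.

Import Order.TTheory GRing.Theory Num.Theory.
Local Open Scope classical_set_scope.
Local Open Scope ring_scope.

HB.mixin Record Lmodule_isLieAlgebra (F : fieldType) V of GRing.Lmodule F V := {
  lie_bracket : V -> V -> V;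
  lie_bracketPl : forall (a : F) (x y z : V),
    lie_bracket (a *: x + y) z = a *: lie_bracket x z + lie_bracket y z;
  lie_bracketPr : forall (a : F) (x y z : V),
    lie_bracket z (a *: x + y) = a *: lie_bracket z x + lie_bracket z y;
  lie_bracketxx : forall x : V, lie_bracket x x = 0;
  lie_jacobi : forall x y z : V,
    lie_bracket x (lie_bracket y z) + lie_bracket y (lie_bracket z x)
      + lie_bracket z (lie_bracket x y) = 0
}.

#[short(type="lieAlgType")]
HB.structure Definition LieAlgebra (F : fieldType) :=
  { V of Lmodule_isLieAlgebra F V & GRing.Lmodule F V }.

Section LieAlgebraTheory.
Variables (F : fieldType) (V W : lieAlgType F).

Definition lie_subalgebra (S : set V) : Prop :=
  [/\ S 0,
      forall (a : F) x y, S x -> S y -> S (a *: x + y)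
    & forall x y, S x -> S y -> S (lie_bracket x y)].

Definition lie_generated (S : set V) : set V := smallest lie_subalgebra S.

(* Isomorphism of two Lie subalgebras A and B; only the restriction of the
   ambient function f to A matters. *)
Definition lie_isomorphic (A : set V) (B : set W) : Prop :=
  exists f : V -> W,
    [/\ set_bij A B f,
        forall (a : F) x y, A x -> A y -> f (a *: x + y) = a *: f x + f y
      & forall x y, A x -> A y -> f (lie_bracket x y) = lie_bracket (f x) (f y)].

End LieAlgebraTheory.

Section MatrixLieAlgebra.
Variables (F : fieldType) (r : nat).

Definition commmx (A B : 'M[F]_r) : 'M[F]_r := A *m B - B *m A.

Lemma commmxPl a x y z : commmx (a *: x + y) z = a *: commmx x z + commmx y z.
Proof.
rewrite /commmx mulmxDl mulmxDr -scalemxAl -scalemxAr scalerBr.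
by rewrite opprD addrACA.
Qed.

Lemma commmxPr a x y z : commmx z (a *: x + y) = a *: commmx z x + commmx z y.
Proof.
rewrite /commmx mulmxDl mulmxDr -scalemxAl -scalemxAr scalerBr.
by rewrite opprD addrACA.
Qed.

Lemma commmxxx x : commmx x x = 0. Proof. exact: subrr. Qed.

Lemma commmx_jacobi x y z :
  commmx x (commmx y z) + commmx y (commmx z x) + commmx z (commmx x y) = 0.
Proof.
rewrite /commmx !mulmxBl !mulmxBr !mulmxA !opprB.
move: (x *m y *m z) (x *m z *m y) (y *m x *m z) (y *m z *m x)
  (z *m x *m y) (z *m y *m x) => a b c d e f.
by apply/matrixP => i j; rewrite !mxE; ring.
Qed.

HB.instance Definition _ :=
  Lmodule_isLieAlgebra.Build F 'M[F]_r commmxPl commmxPr commmxxx commmx_jacobi.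

Definition sl : set 'M[F]_r := [set A | \tr A = 0].

End MatrixLieAlgebra.

Arguments sl : clear implicits.

Section Derivations.
Variables (F L : fieldType) (j : {rmorphism F -> L}).

(* L is an F-algebra through j. *)
Definition is_derivation (D : L -> L) : Prop :=
  [/\ forall x y, D (x + y) = D x + D y,
      forall x y, D (x * y) = D x * y + x * D y
    & forall a x, D (j a * x) = j a * D x].

Definition is_derivationb : {pred (L -> L)} := fun D => `[< is_derivation D >].

Definition Der := {D : L -> L | is_derivationb D}.
HB.instance Definition _ := [isSub of Der for sval].
HB.instance Definition _ := [Choice of Der by <:].

Fact derivation_zmod_closed : zmod_closed is_derivationb.
Proof.
split=> [|D D' /asboolP[DD DM DZ] /asboolP[D'D D'M D'Z]]; apply/asboolP; split.
- by move=> x y /=; rewrite addr0.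
- by move=> x y /=; rewrite mul0r mulr0 addr0.
- by move=> a x /=; rewrite mulr0.
- by move=> x y; rewrite !fctE DD D'D opprD addrACA.
- move=> x y; rewrite !fctE DM D'M mulrBl mulrBr opprD.
  by rewrite addrACA.
- by move=> a x; rewrite !fctE DZ D'Z mulrBr.
Qed.
HB.instance Definition _ :=
  GRing.isZmodClosed.Build (L -> L) is_derivationb derivation_zmod_closed.
HB.instance Definition _ := [SubChoice_isSubZmodule of Der by <:].

Definition der_fun (D : Der) : L -> L := val D.
Coercion der_fun : Der >-> Funclass.

Lemma derP (D : Der) : is_derivation D.
Proof. by apply/asboolP; exact: (valP D). Qed.

Lemma der_ext (D D' : Der) : (forall x, D x = D' x) -> D = D'.
Proof. by move=> DD'; apply/val_inj/funext. Qed.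

Lemma derD (D D' : Der) x : (D + D' : Der) x = D x + D' x. Proof. by []. Qed.

Definition mkDer (D : L -> L) (hD : is_derivation D) : Der :=
  exist (fun E => is_derivationb E) D (introT (asboolP _) hD).

Fact der_scale_subproof (a : F) (D : Der) :
  is_derivation (fun x => j a * D x).
Proof.
have [DD DM DZ] := derP D; split=> [x y|x y|b x].
- by rewrite DD mulrDr.
- by rewrite DM mulrDr mulrA (mulrCA x).
- by rewrite DZ mulrCA.
Qed.
Definition der_scale a D : Der := mkDer (der_scale_subproof a D).

Fact der_scaleE a D x : der_scale a D x = j a * D x. Proof. by []. Qed.
Fact der_scaleA a b D : der_scale a (der_scale b D) = der_scale (a * b) D.
Proof. by apply: der_ext => x; rewrite !der_scaleE rmorphM mulrA. Qed.
Fact der_scale1 : left_id 1 der_scale.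
Proof. by move=> D; apply: der_ext => x; rewrite der_scaleE rmorph1 mul1r. Qed.
Fact der_scaleDr : right_distributive der_scale +%R.
Proof. by move=> a D D'; apply: der_ext => x; rewrite derD !der_scaleE derD mulrDr. Qed.
Fact der_scaleDl D : {morph der_scale^~ D : a b / a + b}.
Proof. by move=> a b; apply: der_ext => x; rewrite derD !der_scaleE rmorphD mulrDl. Qed.

HB.instance Definition _ := GRing.Zmodule_isLmodule.Build F Der
  der_scaleA der_scale1 der_scaleDr der_scaleDl.

Lemma derZ a (D : Der) x : (a *: D : Der) x = j a * D x. Proof. by []. Qed.

Fact der_bracket_subproof (D D' : Der) :
  is_derivation (fun x => D (D' x) - D' (D x)).
Proof.
have [DD DM DZ] := derP D; have [D'D D'M D'Z] := derP D'; split=> [x y|x y|b x].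
- by rewrite DD !D'D DD opprD addrACA.
- by rewrite DM !D'M DD D'D !DM !D'M; ring.
- by rewrite D'Z !DZ D'Z mulrBr.
Qed.
Definition der_bracket D D' : Der := mkDer (der_bracket_subproof D D').


Fact der_bracketE D D' x : der_bracket D D' x = D (D' x) - D' (D x).
Proof. by []. Qed.
Fact der_bracketPl a x y z :
  der_bracket (a *: x + y) z = a *: der_bracket x z + der_bracket y z.
Proof.
have [zD _ zZ] := derP z; apply: der_ext => t.
by rewrite !(derD, derZ, der_bracketE) zD zZ; ring.
Qed.
Fact der_bracketPr a x y z :
  der_bracket z (a *: x + y) = a *: der_bracket z x + der_bracket z y.
Proof.
have [zD _ zZ] := derP z; apply: der_ext => t.
by rewrite !(derD, derZ, der_bracketE) zD zZ; ring.
Qed.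
Fact der_bracketxx x : der_bracket x x = 0.
Proof. by apply: der_ext => t; rewrite der_bracketE subrr. Qed.
Fact der_jacobi x y z :
  der_bracket x (der_bracket y z) + der_bracket y (der_bracket z x)
    + der_bracket z (der_bracket x y) = 0.
Proof.
have derB (D : Der) u v : D (u - v) = D u - D v.
  by have [DD _ DZ] := derP D; rewrite DD -mulN1r -(rmorphN1 j) DZ rmorphN1 mulN1r.
apply: der_ext => t; rewrite !(derD, der_bracketE) !derB.
rewrite -[RHS]/(0 : L); ring.
Qed.

HB.instance Definition _ := Lmodule_isLieAlgebra.Build F Der
  der_bracketPl der_bracketPr der_bracketxx der_jacobi.

End Derivations.

Section Restriction.
Variables (k F L : fieldType) (i : {rmorphism k -> F}) (j : {rmorphism F -> L}).

Fact der_restr_subproof (D : Der j) : is_derivation (j \o i) D.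
Proof. by have [DD DM DZ] := derP D; split=> // a x /=; rewrite DZ. Qed.

(* An F-derivation, seen as a k-derivation. *)
Definition der_restr (D : Der j) : Der (j \o i) := mkDer (der_restr_subproof D).

End Restriction.

(* Finitely supported functions M -> R, with the convolution product;
   multinomials only provides this product for monoids without units. *)
Definition group_algebra (R : comNzRingType) (M : zmodType) : Type :=
  monalg.malg M R.

Section GroupAlgebra.
Variables (R : comNzRingType) (M : zmodType).
Local Notation A := (group_algebra R M).
Implicit Types (f g : A) (u v : M).

HB.instance Definition _ := GRing.Lmodule.copy A (monalg.malg M R).

Definition ga_const (c : R) : A := monalg.mkmalgU 0 c.
Definition ga_char (u : M) : A := monalg.mkmalgU u 1.

Definition ga_mul f g : A :=
  \sum_(u <- monalg.msupp f) \sum_(v <- monalg.msupp g)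
    monalg.mkmalgU (u + v) (monalg.mcoeff u f * monalg.mcoeff v g).

Local Notation U := (monalg.mkmalgU : M -> R -> A).

Fact ga_mulw (d1 d2 : {fset M}) f g :
  (monalg.msupp f `<=` d1)%fset -> (monalg.msupp g `<=` d2)%fset ->
  ga_mul f g = \sum_(u <- d1) \sum_(v <- d2)
    U (u + v) (monalg.mcoeff u f * monalg.mcoeff v g).
Proof.
move=> le1 le2; rewrite /ga_mul (big_fset_incl _ le1) /=.
  apply/eq_bigr=> u _; apply/big_fset_incl => // v _ /monalg.mcoeff_outdom ->.
  by rewrite mulr0 monalg.monalgU0.
move=> u _ /monalg.mcoeff_outdom fu.
by rewrite big1 // => v _; rewrite fu mul0r monalg.monalgU0.
Qed.

Fact ga_mulC : commutative ga_mul.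
Proof.
move=> f g; rewrite /ga_mul exchange_big; apply/eq_bigr=> u _.
by apply/eq_bigr=> v _; rewrite mulrC addrC.
Qed.

Fact ga_mulDl : left_distributive ga_mul +%R.
Proof.
move=> f1 f2 g; pose S := (monalg.msupp f1 `|` monalg.msupp f2)%fset.
rewrite (@ga_mulw S (monalg.msupp g) f1) ?fsubsetUl ?fsubset_refl //.
rewrite (@ga_mulw S (monalg.msupp g) f2) ?fsubsetUr ?fsubset_refl //.
rewrite (@ga_mulw S (monalg.msupp g)) ?monalg.msuppD_le ?fsubset_refl //.
rewrite -big_split /=; apply/eq_bigr=> u _.
rewrite -big_split /=; apply/eq_bigr=> v _.
by rewrite monalg.mcoeffD mulrDl monalg.monalgUD.
Qed.

Fact ga_mul0g : left_zero 0 ga_mul.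
Proof. by move=> f; rewrite /ga_mul monalg.msupp0 big_seq_fset0. Qed.

Fact ga_mulUU c1 c2 u v : ga_mul (U u c1) (U v c2) = U (u + v) (c1 * c2).
Proof.
rewrite (@ga_mulw [fset u]%fset [fset v]%fset) ?monalg.msuppU_le //.
by rewrite !big_seq_fset1 !monalg.mcoeffUU.
Qed.

Fact ga_mul_suml I (r : seq I) (F : I -> A) g :
  ga_mul (\sum_(i <- r) F i) g = \sum_(i <- r) ga_mul (F i) g.
Proof. exact: (big_morph (ga_mul^~ g) (fun _ _ => ga_mulDl _ _ _) (ga_mul0g g)). Qed.

Fact ga_mul_sumr I (r : seq I) (F : I -> A) g :
  ga_mul g (\sum_(i <- r) F i) = \sum_(i <- r) ga_mul g (F i).
Proof. by rewrite ga_mulC ga_mul_suml; apply/eq_bigr=> i _; rewrite ga_mulC. Qed.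

Fact ga_sumE f : exists s (c : M -> R), f = \sum_(u <- s) U u (c u).
Proof. by exists (monalg.msupp f), (monalg.mcoeff^~ f); rewrite -monalg.monalgE. Qed.

Fact ga_mulA : associative ga_mul.
Proof.
move: ga_mul ga_mul_suml ga_mul_sumr ga_mulUU => mul mul_suml mul_sumr mulUU.
move=> f g h; have [r [c ->]] := ga_sumE f; have [s [d ->]] := ga_sumE g.
have [t [e ->]] := ga_sumE h; rewrite !mul_suml; apply/eq_bigr=> u _.
rewrite !(mul_sumr _ s) !mul_suml; apply/eq_bigr=> v _.
by rewrite !mul_sumr; apply/eq_bigr=> w _; rewrite !mulUU mulrA addrA.
Qed.

Fact ga_mul1g : left_id (ga_const 1) ga_mul.
Proof.
move=> f; have [s [c ->]] := ga_sumE f; rewrite ga_mul_sumr.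
by apply/eq_bigr=> u _; rewrite ga_mulUU mul1r add0r.
Qed.

Fact ga_constM c d : ga_const (c * d) = ga_mul (ga_const c) (ga_const d).
Proof. by rewrite ga_mulUU addr0. Qed.

Fact ga_1_neq0 : ga_const 1 != 0.
Proof. by rewrite monalg.monalgU_eq0 oner_neq0. Qed.

HB.instance Definition _ := GRing.Zmodule_isComNzRing.Build A
  ga_mulA ga_mulC ga_mul1g ga_mulDl ga_1_neq0.

End GroupAlgebra.

Section GroupAlgebraLattice.
Variables (K : fieldType) (n : nat).
Local Notation M := 'rV[int]_n.
Local Notation A := (group_algebra K M).
Implicit Types (f g : A) (u v : M).

(* Leading terms for the lexicographic order show that A is a domain. *)
Let key u : n.-tuplelexi int := [tuple u 0 i | i < n].

Let key_inj : injective key.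
Proof.
move=> u v /(congr1 (fun t => tnth t)) uv; apply/rowP => i.
by have := congr1 (@^~ i) uv; rewrite !tnth_mktuple.
Qed.

Let key_ltD u v w : (key u < key v)%O -> (key (u + w) < key (v + w))%O.
Proof.
move/ltxi_tuplePlt => [i uv_eq uv_lt]; apply/ltxi_tuplePlt; exists i.
  by move=> l /uv_eq; rewrite !tnth_mktuple !mxE => ->.
by move: uv_lt; rewrite !tnth_mktuple !mxE ltrD2r.
Qed.

Let key_max (s : seq M) : s != [::] ->
  exists2 u, u \in s & forall v, v \in s -> (key v <= key u)%O.
Proof.
elim: s => // x [_ _|y s /(_ isT)[u us umax] _].
  by exists x => [|v]; rewrite inE // => /eqP ->.
have [xu|ux] := leP (key x) (key u).
  by exists u => [|v]; rewrite inE ?us ?orbT // => /predU1P[->|/umax].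
exists x => [|v]; first exact: mem_head.
by rewrite inE => /predU1P[->|/umax vu] //; exact/ltW/(le_lt_trans vu).
Qed.

Let ga_lead f : f != 0 ->
  exists2 u, u \in monalg.msupp f &
    forall v, v \in monalg.msupp f -> (key v <= key u)%O.
Proof.
move=> f0; apply: key_max; apply: contra f0 => /eqP s0; apply/eqP/monalg.malgP=> u.
rewrite monalg.mcoeff0 monalg.mcoeff_outdom //.
by rewrite -[u \in _]/(u \in enum_fset (monalg.msupp f)) s0.
Qed.

Fact ga_integral f g : f * g = 0 -> (f == 0) || (g == 0).
Proof.
apply: contraPT; rewrite negb_or => /andP[/ga_lead[a af amax] /ga_lead[b bg bmax]].
move=> /(congr1 (monalg.mcoeff (a + b))); rewrite monalg.mcoeff0.
have -> : f * g = ga_mul f g by [].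
rewrite /ga_mul raddf_sum /= (big_fsetD1 a) //= raddf_sum /= (big_fsetD1 b) //=.
rewrite monalg.mcoeffUU big1_fset ?addr0 => [|v]; last first.
  rewrite !inE => /andP[vb vg] _; rewrite monalg.mcoeffU.
  by rewrite (inj_eq (addrI a)) (negPf vb).
rewrite big1_fset ?addr0 => [|u]; last first.
  rewrite !inE => /andP[ua uf] _; rewrite raddf_sum /= big1_fset // => v vg _.
  rewrite monalg.mcoeffU; case: eqP => // uvab.
  have ltua : (key u < key a)%O by rewrite lt_neqAle (inj_eq key_inj) ua amax.
  have := key_ltD v ltua; rewrite uvab ltNge.
  suff -> : (key (a + v) <= key (a + b))%O by [].
  have [->|vb] := eqVneq v b; first exact: lexx.
  apply/ltW; rewrite ![a + _]addrC; apply: key_ltD.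
  by rewrite lt_neqAle (inj_eq key_inj) vb bmax.
by apply/eqP; rewrite mulf_neq0 // monalg.mcoeff_neq0.
Qed.

(* {fraction A} requires a (here classical) inverse on the units of A. *)
Let unit : {pred A} := fun f => `[< exists g, g * f = 1 >].
Let inv f : A :=
  if pselect (exists g, g * f = 1) is left h then sval (cid h) else f.

Fact ga_mulVf : {in unit, left_inverse 1 inv *%R}.
Proof.
move=> f /asboolP h; rewrite /inv; case: pselect => // h'.
exact: (svalP (cid h')).
Qed.
Fact ga_unitP f g : g * f = 1 -> f \in unit.
Proof. by move=> gf; apply/asboolP; exists g. Qed.
Fact ga_inv_out : {in [predC unit], inv =1 id}.
Proof. by move=> f /asboolPn h; rewrite /inv; case: pselect. Qed.

HB.instance Definition _ := GRing.ComNzRing_hasMulInverse.Build A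
  ga_mulVf ga_unitP ga_inv_out.
HB.instance Definition _ := GRing.ComUnitRing_isIntegral.Build A ga_integral.

End GroupAlgebraLattice.

Section QuotientField.
Variables (K : fieldType) (n : nat).
Local Notation M := 'rV[int]_n.
Local Notation A := (group_algebra K M).

Fact ga_const_zmod_morphism : zmod_morphism (ga_const M : K -> A).
Proof. by move=> c d; rewrite /ga_const raddfB. Qed.
Fact ga_const_monoid_morphism : monoid_morphism (ga_const M : K -> A).
Proof.
by split=> // c d; exact: ga_constM.
Qed.
HB.instance Definition _ :=
  GRing.isZmodMorphism.Build K A (ga_const M) ga_const_zmod_morphism.
HB.instance Definition _ :=
  GRing.isMonoidMorphism.Build K A (ga_const M) ga_const_monoid_morphism.

Definition rational_functions : fieldType := {fraction A}.

Definition rf_const : {rmorphism K -> rational_functions} :=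
  @tofrac A \o ga_const M.

Definition rf_char (u : M) : rational_functions := tofrac (ga_char K u).

End QuotientField.

(* M = Z^n (row vectors), N = Hom(M, Z) (column vectors), N_Q = 'cV[rat]_n. *)

Definition pairing (R : pzRingType) (n : nat) (v : 'cV[R]_n) (u : 'rV[R]_n) : R :=
  (u *m v) 0 0.

Definition to_rat (n : nat) (v : 'cV[int]_n) : 'cV[rat]_n := map_mx intr v.

Section Fans.
Variable n : nat.
Local Notation NQ := 'cV[rat]_n.
Implicit Types (sigma tau : set NQ) (Sigma : set (set NQ)).

Definition cone (p : nat) (g : 'I_p -> NQ) : set NQ :=
  [set v | exists a : 'I_p -> rat, (forall j, 0 <= a j) /\ v = \sum_j a j *: g j].

(* Over Q every polyhedral cone is rational. *)
Definition polyhedral_cone sigma : Prop := exists p (g : 'I_p -> NQ), sigma = cone g.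

Definition strictly_convex sigma : Prop :=
  forall v, sigma v -> sigma (- v) -> v = 0.

Definition is_face tau sigma : Prop :=
  exists u : 'rV[rat]_n, (forall v, sigma v -> 0 <= pairing v u) /\
    tau = [set v | sigma v /\ pairing v u = 0].

Definition is_fan Sigma : Prop :=
  [/\ finite_set Sigma,
      forall sigma, Sigma sigma -> polyhedral_cone sigma /\ strictly_convex sigma,
      forall sigma tau, Sigma sigma -> is_face tau sigma -> Sigma tau
    & forall sigma tau, Sigma sigma -> Sigma tau ->
        is_face (sigma `&` tau) sigma /\ is_face (sigma `&` tau) tau].

(* The zero vector is not primitive, being equal to 0 *+ 2. *)
Definition primitive (v : 'cV[int]_n) : Prop :=
  forall (d : nat) (w : 'cV[int]_n), v = w *+ d -> d = 1%N.

Definition rays Sigma : set 'cV[int]_n :=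
  [set v | primitive v /\ Sigma (cone (fun _ : 'I_1 => to_rat v))].

(* The toric variety of Sigma has no torus factor. Without this, an almost simple
   set may generate an infinite-dimensional Lie algebra: in Z^3 with rays (1,0,0)
   and (0,1,0), take phi_1 = phi_2 = 1, e_1 = (-1,1,0) and e_2 = (1,-1,1). *)
Definition rays_span Sigma : Prop :=
  forall w : NQ, exists p (g : 'I_p -> 'cV[int]_n) (a : 'I_p -> rat),
    (forall j, rays Sigma (g j)) /\ w = \sum_j a j *: to_rat (g j).

Definition demazure_root Sigma (rho : 'cV[int]_n) (e : 'rV[int]_n) : Prop :=
  [/\ rays Sigma rho, pairing rho e = -1
    & forall rho', rays Sigma rho' -> rho' <> rho -> 0 <= pairing rho' e].

End Fans.

Definition is_root_derivation (K : fieldType) (n : nat)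
    (phi : K) (rho : 'cV[int]_n) (e : 'rV[int]_n) (D : Der (rf_const K n)) : Prop :=
  forall u : 'rV[int]_n,
    D (rf_char K u) = rf_const K n (phi * (pairing rho u)%:~R) * rf_char K (u + e).

Definition proportional (K : fieldType) (V : lmodType K) (x y : V) : Prop :=
  exists c : K, x = c *: y \/ y = c *: x.

(* Conditions on an ordered family; ordS is the cyclic successor of 'I_m. *)
Section Families.
Variables (n m : nat) (Sigma : set (set 'cV[rat]_n)).
Variables (rho : 'I_m -> 'cV[int]_n) (e : 'I_m -> 'rV[int]_n).

Definition cyclic_family : Prop := forall i, 0 < pairing (rho (ordS i)) (e i).

Definition almost_simple_family : Prop :=
  forall i v, rays Sigma v ->
    [/\ v = rho i -> pairing v (e i) = -1,
        v = rho (ordS i) -> pairing v (e i) = 1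
      & v <> rho i -> v <> rho (ordS i) -> pairing v (e i) = 0].

Definition simple_family (k K : fieldType) (incl : k -> K) (phi : 'I_m -> K) : Prop :=
  almost_simple_family /\ exists c : k, \prod_i phi i = incl c.

End Families.

(* s lists, without repetition, the elements of A, of which there are at least two. *)
Definition is_listing (m p : nat) (s : 'I_p -> 'I_m) (A : set 'I_m) : Prop :=
  [/\ (1 < p)%N, injective s & range s = A].

(* A subset of {D_1, ..., D_m} is given by its set A of indices. *)
Section Subsets.
Variables (n m : nat) (Sigma : set (set 'cV[rat]_n)).
Variables (k K : fieldType) (incl : k -> K) (phi : 'I_m -> K).
Variables (rho : 'I_m -> 'cV[int]_n) (e : 'I_m -> 'rV[int]_n).
Implicit Type A : set 'I_m.

Definition cyclic_set A : Prop :=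
  exists p (s : 'I_p -> 'I_m), is_listing s A /\ cyclic_family (rho \o s) (e \o s).

Definition almost_simple_set A : Prop :=
  exists p (s : 'I_p -> 'I_m),
    is_listing s A /\ almost_simple_family Sigma (rho \o s) (e \o s).

Definition simple_set A : Prop :=
  exists p (s : 'I_p -> 'I_m),
    is_listing s A /\ simple_family Sigma (rho \o s) (e \o s) incl (phi \o s).

Definition almost_simple : Prop := almost_simple_set [set: 'I_m].

Definition very_simple : Prop :=
  simple_set [set: 'I_m] /\ forall A, cyclic_set A -> simple_set A.

End Subsets.

(* Every variety has the same function field as any of its nonempty affine open
   subsets, so it suffices to speak of irreducible closed subsets of k^s. *)
Section FunctionField.
Variables (k : fieldType) (s : nat).
Implicit Types Y Z : set ('I_s -> k).

Definition zariski_closed Y : Prop :=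
  exists P : set {mpoly k[s]}, Y = [set y | forall p, P p -> p.@[y] = 0].

Definition affine_variety Y : Prop :=
  [/\ zariski_closed Y, Y !=set0
    & forall Z1 Z2, zariski_closed Z1 -> zariski_closed Z2 ->
        Y `<=` Z1 `|` Z2 -> Y `<=` Z1 \/ Y `<=` Z2].

(* K is the quotient field of the coordinate ring k[x_1..x_s]/I(Y) of Y; h is the
   composition k[x_1..x_s] -> k[Y] -> K. *)
Definition is_function_field Y (K : fieldType) (incl : {rmorphism k -> K}) : Prop :=
  exists h : {rmorphism {mpoly k[s]} -> K},
    [/\ forall c, h c%:MP = incl c,
        forall p, h p = 0 <-> (forall y, Y y -> p.@[y] = 0)
      & forall z, exists p q, h q != 0 /\ z = h p / h q].

End FunctionField.

(* Main.v *)
Require Import Defs.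
From HB Require Import structures.
From mathcomp Require Import all_boot all_order all_algebra.
From mathcomp Require Import boolp classical_sets functions.
From mathcomp Require Import ring.

(** In an almost simple family the root [e i] has
    pairing -1 with [rho i], 1 with [rho (ordS i)] and 0 with every other ray.
    As the rays span, these numbers determine [e i], so the family is a closed
    walk on the graph whose vertices are the [r] distinct rays, with an edge
    [rho i -> rho (ordS i)] for each derivation.

    In homogeneous coordinates [x_a], one for each vertex [a], the root
    derivation of an edge [a -> b] is a multiple of [x_b d/dx_a].  Such operators
    satisfy the commutation relations of the matrix units of [gl_r]
    ([gl_der_bracket]), so that [A |-> sum_(b,a) A_ba x_b d/dx_a] respects
    brackets ([gl_map_bracket]).  It kills the identity matrix when the rays of
    the walk sum to 0, but it is injective on [sl_r] ([gl_map_sl_inj]): for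
    [a <> b] one has [[E_ab, [E_ab, A]] = -2 A_ba E_ab], so a matrix of the kernel
    has no entry off the diagonal, and then a commutator with [E_ab] compares its
    diagonal entries.  On the matrix side, the units [E_ba] of the edges of a
    closed walk through all vertices generate [sl_r], by composing edges along
    paths ([lie_generated_walk]).

    Two points need care.  The coordinates do not live in [K_0(M)]: only their
    ratios do, up to scalars, as the characters of the elements
    [w_b - w_a], where [w] sums the roots along the walk ([partial_sum]).
    And in part (2) the coefficients [phi i] must be absorbed: rescaling [x_a] by
    [lambda a] multiplies the coefficient of an edge [a -> b] by
    [lambda a / lambda b], so one needs [phi] to be a coboundary modulo the
    constants of [k].  Take for [lambda] the partial products of [phi] along the
    walk.  Between two visits of a same vertex the walk runs through a cyclic
    subset, which is simple, so the partial products at the two visits differ by a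
    constant factor; for the whole walk, simplicity of the family says the same
    ([very_simple_coboundary]).  Part (1) is the case where all of [K_0] counts
    as constants and [lambda = 1], so both parts follow from
    [lie_generated_closed_walk]. *)

Set Implicit Arguments.
Unset Strict Implicit.
Unset Printing Implicit Defensive.

Import Order.TTheory GRing.Theory Num.Theory.
Local Open Scope classical_set_scope.
Local Open Scope ring_scope.

(** * Lie algebras and generated subalgebras *)

Section LieBracket.
Variables (F : fieldType) (V : lieAlgType F).
Implicit Types x y z : V.

Lemma lie_bracketDl x y z :
  lie_bracket (x + y) z = lie_bracket x z + lie_bracket y z.
Proof. by have := lie_bracketPl 1 x y z; rewrite !scale1r. Qed.

Lemma lie_bracketDr x y z :
  lie_bracket z (x + y) = lie_bracket z x + lie_bracket z y.
Proof. by have := lie_bracketPr 1 x y z; rewrite !scale1r. Qed.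

Lemma lie_bracket0l z : lie_bracket 0 z = 0.
Proof. by apply: (addrI (lie_bracket 0 z)); rewrite -lie_bracketDl !addr0. Qed.

Lemma lie_bracket0r z : lie_bracket z 0 = 0.
Proof. by apply: (addrI (lie_bracket z 0)); rewrite -lie_bracketDr !addr0. Qed.

Lemma lie_bracketZl a x z : lie_bracket (a *: x) z = a *: lie_bracket x z.
Proof. by have := lie_bracketPl a x 0 z; rewrite lie_bracket0l !addr0. Qed.

Lemma lie_bracketZr a x z : lie_bracket z (a *: x) = a *: lie_bracket z x.
Proof. by have := lie_bracketPr a x 0 z; rewrite lie_bracket0r !addr0. Qed.

Lemma lie_bracket_suml I (s : seq I) (G : I -> V) z :
  lie_bracket (\sum_(i <- s) G i) z = \sum_(i <- s) lie_bracket (G i) z.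
Proof.
exact: (big_morph (lie_bracket^~ z) (fun x y => lie_bracketDl x y z)
  (lie_bracket0l z)).
Qed.

Lemma lie_bracket_sumr I (s : seq I) (G : I -> V) z :
  lie_bracket z (\sum_(i <- s) G i) = \sum_(i <- s) lie_bracket z (G i).
Proof.
exact: (big_morph (lie_bracket z) (fun x y => lie_bracketDr x y z)
  (lie_bracket0r z)).
Qed.

Section Subalgebra.
Context {S : set V} (hS : lie_subalgebra S).

Lemma lie_subalgebraD x y : S x -> S y -> S (x + y).
Proof. by case: hS => _ SP _ Sx Sy; have := SP 1 _ _ Sx Sy; rewrite scale1r. Qed.

Lemma lie_subalgebraZ a x : S x -> S (a *: x).
Proof. by case: hS => S0 SP _ Sx; have := SP a _ _ Sx S0; rewrite addr0. Qed.

Lemma lie_subalgebra_sum I (s : seq I) (P : pred I) (G : I -> V) :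
  (forall i, P i -> S (G i)) -> S (\sum_(i <- s | P i) G i).
Proof.
by case: hS => S0 _ _ SG; elim/big_rec: _ => // i x /SG; exact: lie_subalgebraD.
Qed.

End Subalgebra.

Lemma sub_lie_generated (S : set V) : S `<=` lie_generated S.
Proof. exact: sub_gen_smallest. Qed.

Lemma lie_generated_min (S T : set V) :
  lie_subalgebra T -> S `<=` T -> lie_generated S `<=` T.
Proof. by move=> hT ST; apply: smallest_sub. Qed.

Lemma lie_generated_subalgebra (S : set V) : lie_subalgebra (lie_generated S).
Proof.
split=> [T [[]]//|a x y Sx Sy T [hT ST]|x y Sx Sy T [hT ST]].
  by case: (hT) => _ TP _; apply: TP; [apply: Sx|apply: Sy].
by case: (hT) => _ _ TB; apply: TB; [apply: Sx|apply: Sy].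
Qed.

End LieBracket.

Section Transport.
Variables (F : fieldType) (V W : lieAlgType F) (f : W -> V).
Hypothesis f_lin : forall a x y, f (a *: x + y) = a *: f x + f y.
Hypothesis f_bracket :
  forall x y, f (lie_bracket x y) = lie_bracket (f x) (f y).

Let f0 : f 0 = 0.
Proof.
by apply: (addrI (f 0)); have := f_lin 1 0 0; rewrite !scale1r !addr0.
Qed.

Lemma lie_generated_image (G : set W) :
  lie_generated (f @` G) = f @` lie_generated G.
Proof.
have hG := lie_generated_subalgebra G; apply/seteqP; split.
  apply: lie_generated_min => [|_ [x Gx <-]]; last first.
    by exists x => //; exact: sub_lie_generated.
  case: hG => G0 GP GB; split=> [|a _ _ [x Gx <-] [y Gy <-]|_ _ [x Gx <-] [y Gy <-]].
  - by exists 0.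
  - by exists (a *: x + y); [exact: GP|rewrite f_lin].
  - by exists (lie_bracket x y); [exact: GB|rewrite f_bracket].
suff: lie_generated G `<=` [set x | lie_generated (f @` G) (f x)].
  by move=> sub _ [x Gx <-]; exact: sub.
have [H0 HP HB] := lie_generated_subalgebra (f @` G).
apply: lie_generated_min => [|x Gx]; last by apply: sub_lie_generated; exists x.
split=> [|a x y|x y] /=; first by rewrite f0.
- by rewrite f_lin; exact: HP.
- by rewrite f_bracket; exact: HB.
Qed.

(** The isomorphism must go from the image back to [A] and be defined on all of
    [V], hence a choice of preimages extended by 0. *)
Lemma lie_isomorphic_image (A : set W) : lie_subalgebra A ->
  (forall x, A x -> f x = 0 -> x = 0) -> lie_isomorphic (f @` A) A.
Proof.
move=> hA kerf; have [A0 AP AB] := hA.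
have finj x y : A x -> A y -> f x = f y -> x = y.
  move=> Ax Ay fxy; apply/eqP; rewrite -subr_eq0 addrC -scaleN1r; apply/eqP/kerf.
    exact: AP.
  by rewrite f_lin fxy scaleN1r addNr.
pose g v := if pselect (exists2 x, A x & f x = v) is left h then sval (cid2 h) else 0.
have gK x : A x -> g (f x) = x.
  move=> Ax; rewrite /g; case: pselect => [h|[]]; last by exists x.
  by case: (cid2 h) => /= y Ay; exact: finj.
exists g; split.
- split=> [_ [x Ax <-]|_ _ /set_mem[x Ax <-] /set_mem[y Ay <-]|x Ax].
  + by rewrite /= gK.
  + by rewrite !gK // => ->.
  + by exists (f x); [exists x|exact: gK].
- by move=> a _ _ [x Ax <-] [y Ay <-]; rewrite -f_lin !gK //; exact: AP.
- by move=> _ _ [x Ax <-] [y Ay <-]; rewrite -f_bracket !gK //; exact: AB.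
Qed.

End Transport.

(** * Generators and representations of sl_r *)

Section MatrixUnits.
Variables (F : fieldType) (r : nat).
Implicit Types A B : 'M[F]_r.

Lemma sl_subalgebra : lie_subalgebra (sl F r).
Proof.
split=> [|a A B|A B _ _]; rewrite /sl /=.
- by rewrite linear0.
- by rewrite linearP /= => -> ->; rewrite mulr0 addr0.
- by rewrite [lie_bracket A B]/(commmx A B) raddfB /= mxtrace_mulC subrr.
Qed.

Lemma lie_bracket_delta (b a d c : 'I_r) :
  lie_bracket (delta_mx b a : 'M[F]_r) (delta_mx d c) =
  (a == d)%:R *: delta_mx b c - (b == c)%:R *: delta_mx d a.
Proof.
rewrite [LHS]/(commmx _ _) /commmx !mul_delta_mx_cond (eq_sym c b).
by rewrite !scaler_nat.
Qed.

(** The vertex [o] is arbitrary: when the trace vanishes, subtracting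
    [delta_mx o o] from each diagonal unit subtracts 0 in total. *)
Lemma sl_sum_delta (o : 'I_r) A : \tr A = 0 ->
  A = \sum_i (\sum_(j | j != i) A i j *: delta_mx i j
              + A i i *: (delta_mx i i - delta_mx o o)).
Proof.
move=> trA; rewrite [LHS]matrix_sum_delta.
under [RHS]eq_bigr => i _ do rewrite scalerBr.
rewrite big_split /= sumrB -scaler_suml -/(mxtrace A) trA scale0r subr0.
by rewrite -big_split; apply: eq_bigr => i _; rewrite (bigD1 i) //= addrC.
Qed.

(** Cyclic induction: the successor has a single orbit, and going on past the last
    index is harmless. *)
Lemma ordS_ind (p : nat) (P : 'I_p -> Prop) (i : 'I_p) :
  P i -> (forall j, P j -> P (ordS j)) -> forall j, P j.
Proof.
move=> Pi PS; have Pit t : P (iter t (@ordS p) i) by elim: t => //= t; exact: PS.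
have val_it t : val (iter t (@ordS p) i) = ((i + t) %% p)%N.
  elim: t => [|t /= ->]; first by rewrite addn0 modn_small.
  by rewrite -addn1 modnDml addn1 addnS.
move=> j; have -> : j = iter (j + (p - i)) (@ordS p) i.
  apply: val_inj; rewrite val_it addnCA subnKC ?(ltnW (ltn_ord i)) //.
  by rewrite modnDr modn_small.
exact: Pit.
Qed.

Section Walk.
Variables (p : nat) (v : 'I_p -> 'I_r) (c : 'I_p -> F).
Hypothesis v_surj : forall a, exists i, v i = a.
Hypothesis v_step : forall i, v (ordS i) != v i.
Hypothesis c_neq0 : forall i, c i != 0.

(** Bracketing the units of consecutive edges [a -> b] and [b -> q] gives that of
    [a -> q]; following the walk from [a] thus reaches every unit [delta_mx b a]
    off the diagonal, and the brackets of opposite units give the diagonal part. *)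
Lemma lie_generated_walk :
  lie_generated (range (fun i => c i *: delta_mx (v (ordS i)) (v i))) = sl F r.
Proof.
set G := range _; apply/seteqP; split.
  apply: (lie_generated_min sl_subalgebra) => _ [i _ <-].
  rewrite /sl /= linearZ /= /mxtrace big1 ?mulr0 // => a _; rewrite mxE.
  by case: eqP => // ->; rewrite (negPf (v_step i)).
have hS := lie_generated_subalgebra G; have [_ _ SB] := hS.
have S_step i : lie_generated G (delta_mx (v (ordS i)) (v i)).
  rewrite -[delta_mx _ _]scale1r -(mulVf (c_neq0 i)) -scalerA.
  by apply: (lie_subalgebraZ hS); apply: sub_lie_generated; exists i.
have S_off a b : a != b -> lie_generated G (delta_mx b a).
  have [[i <-] [j <-]] := (v_surj a, v_surj b).
  move: j; apply: (@ordS_ind _ _ i) => [|j IH vij]; first by rewrite eqxx.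
  (* Back at the starting vertex, the path restarts with the next edge. *)
  have [vij_eq|vij'] := eqVneq (v i) (v j); first by rewrite vij_eq; exact: S_step.
  have := SB _ _ (S_step j) (IH vij').
  by rewrite lie_bracket_delta eqxx scale1r eq_sym (negPf vij) scale0r subr0.
have S_diag a b : lie_generated G (delta_mx a a - delta_mx b b).
  have [->|ab] := eqVneq a b; first by rewrite subrr; case: hS.
  have ba : b != a by rewrite eq_sym.
  have := SB _ _ (S_off _ _ ba) (S_off _ _ ab).
  by rewrite lie_bracket_delta !eqxx !scale1r.
move=> A /= trA; have [o _|r0] := pickP (@predT 'I_r); last first.
  have -> : A = 0 by apply/matrixP => i; have := r0 i.
  by case: hS.
rewrite (sl_sum_delta o trA); apply: (lie_subalgebra_sum hS) => i _.
apply: (lie_subalgebraD hS); last by apply: (lie_subalgebraZ hS).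
apply: (lie_subalgebra_sum hS) => j ji.
by apply: (lie_subalgebraZ hS); exact: S_off.
Qed.

End Walk.

Section Representation.
Variables (V : lieAlgType F) (E : 'I_r -> 'I_r -> V).
Hypothesis E_bracket : forall b a d c, lie_bracket (E b a) (E d c) =
  (a == d)%:R *: E b c - (b == c)%:R *: E d a.

Definition gl_map A : V := \sum_b \sum_a A b a *: E b a.

Lemma gl_map_linear c A B : gl_map (c *: A + B) = c *: gl_map A + gl_map B.
Proof.
rewrite /gl_map scaler_sumr -big_split; apply: eq_bigr => b _ /=.
rewrite scaler_sumr -big_split; apply: eq_bigr => a _ /=.
by rewrite !mxE scalerDl scalerA.
Qed.

Lemma gl_map_delta b a : gl_map (delta_mx b a) = E b a.
Proof.
rewrite /gl_map (bigD1 b) //= [X in _ + X]big1 ?addr0 => [|d db]; last first.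
  by rewrite big1 // => c _; rewrite mxE (negPf db) scale0r.
rewrite (bigD1 a) //= [X in _ + X]big1 ?addr0 => [|c ca]; last first.
  by rewrite mxE eqxx (negPf ca) scale0r.
by rewrite mxE !eqxx scale1r.
Qed.

Lemma gl_map0 : gl_map 0 = 0.
Proof.
by apply: (addrI (gl_map 0)); have := gl_map_linear 1 0 0; rewrite !scale1r !addr0.
Qed.

Lemma gl_mapD A B : gl_map (A + B) = gl_map A + gl_map B.
Proof. by have := gl_map_linear 1 A B; rewrite !scale1r. Qed.

Lemma gl_mapZ c A : gl_map (c *: A) = c *: gl_map A.
Proof. by have := gl_map_linear c A 0; rewrite gl_map0 !addr0. Qed.

Lemma gl_map_sum I (s : seq I) (G : I -> 'M[F]_r) :
  gl_map (\sum_(i <- s) G i) = \sum_(i <- s) gl_map (G i).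
Proof. exact: (big_morph gl_map gl_mapD gl_map0). Qed.

Lemma gl_map_bracket A B :
  gl_map (lie_bracket A B) = lie_bracket (gl_map A) (gl_map B).
Proof.
rewrite (matrix_sum_delta A) (matrix_sum_delta B).
rewrite !gl_map_sum !lie_bracket_suml gl_map_sum; apply: eq_bigr => b _.
rewrite !gl_map_sum !lie_bracket_suml gl_map_sum; apply: eq_bigr => a _.
rewrite ?gl_map_sum !lie_bracket_sumr gl_map_sum; apply: eq_bigr => d _.
rewrite ?gl_map_sum !lie_bracket_sumr gl_map_sum; apply: eq_bigr => c _.
rewrite !gl_mapZ !lie_bracketZl !lie_bracketZr !gl_mapZ !gl_map_delta E_bracket.
by rewrite lie_bracket_delta gl_mapD -scaleN1r !gl_mapZ !gl_map_delta scaleN1r.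
Qed.

Hypothesis char0 : [pchar F] =i pred0.
Hypothesis E_neq0 : forall b a, b != a -> E b a != 0.

Let natF_neq0 d : (0 < d)%N -> (d%:R : F) != 0.
Proof. by move=> d0; rewrite ((pcharf0P F).1 char0) -lt0n. Qed.

(** The kernel is stable under brackets.  A double bracket with [delta_mx a b]
    isolates the entry [A b a] up to the factor -2, and a single one isolates
    [A a a - A b b] once [A] is diagonal; a scalar matrix of trace 0 vanishes in
    characteristic 0. *)
Lemma gl_map_sl_inj A : sl F r A -> gl_map A = 0 -> A = 0.
Proof.
rewrite /sl /= => trA fA.
have fE x b a : b != a -> gl_map (x *: delta_mx b a) = 0 -> x = 0.
  move=> ba /eqP; rewrite gl_mapZ gl_map_delta scaler_eq0.
  by rewrite (negPf (E_neq0 ba)) orbF => /eqP.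
have A_off b a : b != a -> A b a = 0.
  move=> ba; have ab : a != b by rewrite eq_sym.
  have AE : lie_bracket (delta_mx a b) (lie_bracket (delta_mx a b) A) =
            (- (2%:R * A b a)) *: delta_mx a b :> 'M[F]_r.
    have EAE : delta_mx a b *m A *m delta_mx a b = A b a *: delta_mx a b.
      apply/matrixP => i j; rewrite !mxE (bigD1 a) //= big1 ?addr0; last first.
        by move=> l la; rewrite mxE [delta_mx _ _ _ _]mxE (negPf la) mulr0.
      rewrite mxE (bigD1 b) //= big1 ?addr0; last first.
        by move=> l lb; rewrite mxE (negPf lb) andbF mul0r.
      rewrite !mxE !eqxx; case: eqP; case: eqP;
        by rewrite /= ?(mul1r, mulr1, mul0r, mulr0).
    rewrite [LHS]/(commmx _ (commmx _ _)) /commmx !mulmxBr !mulmxBl !mulmxA.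
    rewrite mul_delta_mx_0 // mul0mx sub0r EAE -mulmxA mul_delta_mx_0 // mulmx0 subr0.
    by rewrite -opprD scaleNr mulr_natl mulr2n scalerDl.
  have : gl_map (- (2%:R * A b a) *: delta_mx a b) = 0.
    by rewrite -AE !gl_map_bracket fA !lie_bracket0r.
  move/(fE _ _ _ ab)/eqP; rewrite oppr_eq0 mulf_eq0.
  by rewrite (negPf (natF_neq0 _)) //= => /eqP.
have A_diag a b : A a a = A b b.
  have [->//|ab] := eqVneq a b; apply/eqP; rewrite -subr_eq0; apply/eqP.
  apply: (fE _ _ _ ab).
  have <- : lie_bracket A (delta_mx a b) = (A a a - A b b) *: delta_mx a b.
    rewrite [LHS]/(commmx _ _) /commmx; apply/matrixP => i j; rewrite !mxE.
    rewrite (bigD1 a) //= big1 ?addr0; last first.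
      by move=> l la; rewrite mxE (negPf la) mulr0.
    rewrite (bigD1 b) //= big1 ?addr0; last first.
      by move=> l lb; rewrite mxE (negPf lb) andbF mul0r.
    rewrite !mxE !eqxx andbT /=.
    case: (eqVneq i a) => [->|ia]; case: (eqVneq j b) => [->|jb];
      rewrite /= ?(mul1r, mulr1, mul0r, mulr0, subr0, sub0r) //.
    - by rewrite A_off ?oppr0 // eq_sym.
    - by rewrite A_off.
    - by rewrite oppr0.
  by rewrite gl_map_bracket fA lie_bracket0l.
apply/matrixP => i j; rewrite mxE; have [<-{j}|ij] := eqVneq i j; last exact: A_off.
apply/eqP; move: trA; rewrite /mxtrace (eq_bigr (fun=> A i i)) => [|l _]; last first.
  exact: A_diag.
rewrite sumr_const card_ord -mulr_natl => /eqP; rewrite mulf_eq0.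
by rewrite (negPf (natF_neq0 _)) // (leq_ltn_trans _ (ltn_ord i)).
Qed.

End Representation.
End MatrixUnits.

(** * Derivations satisfying the relations of the matrix units *)

Section DerivationTheory.
Variables (F L : fieldType) (j : {rmorphism F -> L}).
Implicit Types (D : Der j) (x y f : L).

Lemma der0 D : D 0 = 0.
Proof. by have [DD _ _] := derP D; apply: (addrI (D 0)); rewrite -DD !addr0. Qed.

Lemma der_sum D I (s : seq I) (G : I -> L) :
  D (\sum_(i <- s) G i) = \sum_(i <- s) D (G i).
Proof. by have [DD _ _] := derP D; exact: (big_morph (D : L -> L) DD (der0 D)). Qed.

Fact der_mull_subproof y D : is_derivation j (fun x => y * D x).
Proof.
have [DD DM DZ] := derP D; split=> [x z|x z|a x].
- by rewrite DD mulrDr.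
- by rewrite DM; ring.
- by rewrite DZ mulrCA.
Qed.
Definition der_mull y D : Der j := mkDer (der_mull_subproof y D).

Lemma der_mullE y D x : der_mull y D x = y * D x. Proof. by []. Qed.

(** Here [d a] stands for the Euler operator [x_a d/dx_a], which multiplies a
    monomial by its degree in [x_a].  Only the values on ratios are prescribed, since
    [d a] need not act on [x b] itself as it would on a coordinate. *)
Section EulerDerivations.
Variables (r : nat) (x : 'I_r -> L) (d : 'I_r -> Der j).
Hypothesis x_neq0 : forall a, x a != 0.
Hypothesis d_ratio : forall a b c,
  d a (x b / x c) = ((a == b)%:R - (a == c)%:R) * (x b / x c).
Hypothesis dC : forall a b f, d a (d b f) = d b (d a f).

(** This is [x_b d/dx_a]. *)
Definition gl_der b a : Der j := der_mull (x b / x a) (d a).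

(** The second order terms cancel since the [d a] commute; a contribution of
    [a = c] appears twice with opposite signs, and the two others contract
    [x_b / x_a * (x_e / x_c)] to a single ratio. *)
Lemma gl_der_bracket b a e c : lie_bracket (gl_der b a) (gl_der e c) =
  (a == e)%:R *: gl_der b c - (b == c)%:R *: gl_der e a.
Proof.
apply: der_ext => f.
have [_ daM _] := derP (d a); have [_ dcM _] := derP (d c).
rewrite -scaleNr derD !derZ rmorphN /= !rmorph_nat [LHS]der_bracketE !der_mullE.
rewrite daM dcM !d_ratio (dC c a).
move: (d a (d c f)) => g.
have xM u v w : x u / x v * (x v / x w) = x u / x w by rewrite mulrA divfK.
have ae : (a == e)%:R * (x b / x a * (x e / x c)) = (a == e)%:R * (x b / x c) :> L.
  by case: eqP => [<-|_]; rewrite ?mul0r ?xM.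
have bc : (b == c)%:R * (x b / x a * (x e / x c)) = (b == c)%:R * (x e / x a) :> L.
  by case: eqP => [<-|_]; rewrite ?mul0r // mulrC [_ / x a * _]mulrC xM mulrC.
have ac : (a == c)%:R * d a f = (a == c)%:R * d c f.
  by case: eqP => [->|_]; rewrite ?mul0r.
rewrite (eq_sym c b) (eq_sym c a) (mulrA _ (x b / x c)) -ae.
rewrite mulNr (mulrA _ (x e / x a)) -bc.
transitivity ((a == e)%:R * (x b / x a * (x e / x c)) * d c f
  - (b == c)%:R * (x b / x a * (x e / x c)) * d a f
  + (x b / x a * (x e / x c)) * ((a == c)%:R * d a f - (a == c)%:R * d c f)).
  by move: (x b / x a) (x e / x c) => p q; ring.
by rewrite ac subrr mulr0 addr0.
Qed.

End EulerDerivations.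
End DerivationTheory.

(** * The field of rational functions *)

Lemma fraction_numden (R : idomainType) (x : {fraction R}) :
  exists f g, g != 0 /\ x * tofrac g = tofrac f.
Proof.
elim/generic_quotient.quotW: x => x; exists (frac x).1, (frac x).2.
split; first exact: denom_ratioP.
rewrite !generic_quotient.piE /FracField.mulf.
apply/generic_quotient.eqmodP.
rewrite /= FracField.equivfE !numden_Ratio ?oner_eq0 ?mulr1 ?denom_ratioP //.
by rewrite mulrC.
Qed.

Section RationalFunctions.
Variables (K : fieldType) (n : nat).
Local Notation L := (rational_functions K n).
Local Notation const := (rf_const K n).
Local Notation chi := (rf_char K).
Implicit Types u v : 'rV[int]_n.

Lemma rf_char0 : chi 0 = 1 :> L. 
Proof. exact: rmorph1. Qed.

Lemma rf_charD u v : chi (u + v) = chi u * chi v.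
Proof.
rewrite /rf_char -rmorphM; congr (tofrac _).
by have := ga_mulUU (1 : K) 1 u v; rewrite mulr1 => /esym.
Qed.

(** The characters generate the field over the constants, so a derivation that
    kills the constants is determined by its values on them; the value on a
    fraction follows from the Leibniz rule applied to the numerator. *)
Lemma der_rf_char_ext (D D' : Der const) :
  (forall u, D (chi u) = D' (chi u)) -> D = D'.
Proof.
move=> DD'; apply: der_ext => x.
have [_ DM DZ] := derP D; have [_ D'M D'Z] := derP D'.
have DD'A f : D (tofrac f) = D' (tofrac f).
  have [s [c ->]] := ga_sumE f; rewrite rmorph_sum !der_sum.
  apply: eq_bigr => u _.
  have -> : monalg.mkmalgU u (c u) =
      ga_const 'rV[int]_n (c u) * ga_char K u :> group_algebra K _.
    by have := ga_mulUU (c u) 1 0 u; rewrite add0r mulr1 => /esym.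
  by rewrite rmorphM -/(const _) -/(chi u) DZ DD' -D'Z.
have [f [g [g0 xg]]] := fraction_numden x.
have gF0 : tofrac g != 0 :> L by rewrite tofrac_eq0.
have := DD'A f; rewrite -xg DM D'M DD'A => /addIr; exact: mulIf.
Qed.

End RationalFunctions.

(** * Roots of an almost simple family *)

Section Pairing.
Variable n : nat.
Implicit Types (v : 'cV[int]_n) (u : 'rV[int]_n).

Lemma pairingD v u u' : pairing v (u + u') = pairing v u + pairing v u'.
Proof. by rewrite /pairing mulmxDl mxE. Qed.

Lemma pairing0 v : pairing v 0 = 0.
Proof. by rewrite /pairing mul0mx mxE. Qed.

Lemma pairingB v u u' : pairing v (u - u') = pairing v u - pairing v u'.
Proof. by rewrite /pairing mulmxBl !mxE. Qed.

Lemma rays_span_separate (Sigma : set (set 'cV[rat]_n)) u : rays_span Sigma ->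
  (forall v, rays Sigma v -> pairing v u = 0) -> u = 0.
Proof.
move=> hspan u0; apply/rowP => i; rewrite mxE; apply: (@intr_inj rat).
have [q [g [a [hg wE]]]] := hspan (delta_mx i 0).
have -> : (u 0 i)%:~R = pairing (delta_mx i 0) (map_mx intr u) :> rat.
  by rewrite /pairing -colE !mxE.
rewrite wE /pairing mulmx_sumr summxE big1 // => l _.
rewrite -scalemxAr mxE /to_rat -map_mxM mxE.
by have := u0 _ (hg l); rewrite /pairing => ->; rewrite mulr0.
Qed.

End Pairing.

Section AlmostSimpleFamily.
Variables (n p : nat) (Sigma : set (set 'cV[rat]_n)).
Variables (rho : 'I_p -> 'cV[int]_n) (e : 'I_p -> 'rV[int]_n).
Hypothesis e_almost_simple : almost_simple_family Sigma rho e.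
Hypothesis rho_rays : forall i, rays Sigma (rho i).

Lemma almost_simple_step i : rho (ordS i) != rho i.
Proof.
apply/eqP => rhoS; have [/(_ erefl) em _ _] := e_almost_simple i (rho_rays i).
by have [_ /(_ (esym rhoS))] := e_almost_simple i (rho_rays i); rewrite em.
Qed.

Lemma almost_simple_pairing i v : rays Sigma v ->
  pairing v (e i) = (v == rho (ordS i))%:R - (v == rho i)%:R.
Proof.
move=> hv; have [em ep e0] := e_almost_simple i hv.
have [vi|vi] := eqVneq v (rho i).
  by rewrite em // vi eq_sym (negPf (almost_simple_step i)) sub0r.
have [vS|vS] := eqVneq v (rho (ordS i)); first by rewrite ep // subr0.
by rewrite e0 ?subr0 //; exact/eqP.
Qed.

(** The weight of the homogeneous coordinate at the vertex [rho i], normalised to be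
    0 where the walk starts. *)
Definition partial_sum (i : nat) : 'rV[int]_n := \sum_(l < p | (l < i)%N) e l.

Lemma pairing_partial_sum (v : 'cV[int]_n) (i j : 'I_p) : rays Sigma v ->
  pairing v (partial_sum i) - pairing v (partial_sum j) =
  (v == rho i)%:R - (v == rho j)%:R.
Proof.
move=> hv; have p_gt0 : (0 < p)%N by exact: leq_ltn_trans (ltn_ord i).
suff H (l : 'I_p) : pairing v (partial_sum l) =
    (v == rho l)%:R - (v == rho (Ordinal p_gt0))%:R by rewrite !H; ring.
case: l => l; elim: l => [|l IH] lp /=.
  rewrite /partial_sum big_pred0 // pairing0; apply/esym/eqP; rewrite subr_eq0.
  by apply/eqP; congr (nat_of_bool (_ == rho _))%:R; exact: val_inj.
have lp' : (l < p)%N := ltnW lp.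
have -> : partial_sum l.+1 = partial_sum l + e (Ordinal lp').
  rewrite /partial_sum (bigD1 (Ordinal lp')) /= ?ltnSn // addrC; congr (_ + _).
  by apply: eq_bigl => q; rewrite -val_eqE /= ltnS ltn_neqAle andbC.
rewrite pairingD (IH lp') almost_simple_pairing //.
have -> : ordS (Ordinal lp') = Ordinal lp by apply: val_inj; rewrite /= modn_small.
by rewrite addrC addrA subrK.
Qed.

(** The wrap-around of the cyclic order is not a special case: separation by the
    rays identifies the last root just as the others, and the partial sum may be
    taken at any index with the same ray. *)
Lemma root_partial_sum (i a b : 'I_p) : rays_span Sigma ->
  rho a = rho (ordS i) -> rho b = rho i ->
  e i = partial_sum a - partial_sum b.
Proof.
move=> hspan ra rb; apply/eqP; rewrite -subr_eq0; apply/eqP.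
apply: (rays_span_separate hspan) => v hv.
by rewrite !pairingB pairing_partial_sum // almost_simple_pairing // ra rb subrr.
Qed.

End AlmostSimpleFamily.

(** * The Lie algebra generated by a closed walk *)

(** [L] is an extension of [K] whose [K]-derivations are determined by their values on
    the multiplicative characters [chi], and [F] is the field of constants over which
    the Lie algebra is generated.  The derivation [D' i] is the map [D i], which is
    [K]-linear, seen as an [F]-derivation.  The map [sigma] sends an index to the
    vertex of its ray, and [tau] picks an index for each vertex. *)
Section LieAlgebraOfClosedWalk.
Variables (F K L : fieldType) (iota : {rmorphism F -> K}) (n : nat).
Variables (const : {rmorphism K -> L}) (chi : 'rV[int]_n -> L).
Hypothesis chi0 : chi 0 = 1.
Hypothesis chiD : forall u v, chi (u + v) = chi u * chi v.
Hypothesis chi_ext : forall D D' : Der const,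
  (forall u, D (chi u) = D' (chi u)) -> D = D'.
Variable j : {rmorphism F -> L}.
Hypothesis j_const : forall c, j c = const (iota c).
Hypothesis char0 : [pchar F] =i pred0.
Variables (p : nat) (Sigma : set (set 'cV[rat]_n)).
Hypothesis Sigma_span : rays_span Sigma.
Variables (phi : 'I_p -> K) (rho : 'I_p -> 'cV[int]_n) (e : 'I_p -> 'rV[int]_n).
Hypothesis rho_rays : forall i, rays Sigma (rho i).
Hypothesis e_almost_simple : almost_simple_family Sigma rho e.
Hypothesis phi_neq0 : forall i, phi i != 0.
Variables (D : 'I_p -> Der const) (D' : 'I_p -> Der j).
Hypothesis D_root : forall i, forall u,
  D i (chi u) = const (phi i * (pairing (rho i) u)%:~R) * chi (u + e i).
Hypothesis D'E : forall i x, D' i x = D i x.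
Variables (r : nat) (sigma : 'I_p -> 'I_r) (tau : 'I_r -> 'I_p).
Hypothesis sigmaP : forall i l, sigma i = sigma l <-> rho i = rho l.
Hypothesis tauK : cancel tau sigma.
Variables (lambda : 'I_r -> K) (c : 'I_p -> F).
Hypothesis lambda_neq0 : forall a, lambda a != 0.
Hypothesis phiE :
  forall i, phi i = iota (c i) * (lambda (sigma (ordS i)) / lambda (sigma i)).

Let rho_tau i : rho (tau (sigma i)) = rho i.
Proof. by apply/sigmaP; rewrite tauK. Qed.

Let rho_tau_eq a b : (rho (tau a) == rho (tau b)) = (a == b).
Proof.
apply/eqP/eqP => [/sigmaP|-> //]; by rewrite !tauK.
Qed.

Let chi_neq0 u : chi u != 0.
Proof.
apply/eqP => u0; have := chiD u (- u).
by rewrite u0 mul0r subrr chi0 => /eqP; rewrite oner_eq0.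
Qed.

Let chiB u v : chi (u - v) = chi u / chi v.
Proof. by apply/(canRL (mulfK (chi_neq0 v))); rewrite -chiD subrK. Qed.

Let const_neq0 z : z != 0 -> const z != 0. Proof. by rewrite fmorph_eq0. Qed.

(* The Euler operator of the vertex a, obtained by dividing out the coefficient of
   a root derivation with the ray of a, so that no derivation has to be extended to
   the fractions by hand. *)
Let scal a := (const (phi (tau a)) * chi (e (tau a)))^-1.
Let d a : Der const := der_mull (scal a) (D (tau a)).
Let d' a : Der j := der_mull (scal a) (D' (tau a)).

Let d'E a x : d' a x = d a x.
Proof. by rewrite /d' /d !der_mullE D'E. Qed.

Let d_char a u : d a (chi u) = const (pairing (rho (tau a)) u)%:~R * chi u.
Proof.
rewrite /d der_mullE D_root rmorphM [u + _]addrC chiD mulrACA mulKf //.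
by rewrite mulf_neq0 ?chi_neq0 // const_neq0.
Qed.

Let d_monomial a z u :
  d a (const z * chi u) = const (pairing (rho (tau a)) u)%:~R * (const z * chi u).
Proof. by have [_ _ ->] := derP (d a); rewrite d_char mulrCA. Qed.

(* Commutation is tested on the characters, on which these operators are
   diagonal; this uses linearity over K and not only over F. *)
Let dC a b x : d a (d b x) = d b (d a x).
Proof.
suff /(congr1 (fun E : Der const => E x))/eqP : lie_bracket (d a) (d b) = 0.
  by rewrite [X in X == _]der_bracketE subr_eq0 => /eqP.
apply: chi_ext => u; rewrite [LHS]der_bracketE !d_char !d_monomial.
by rewrite mulrCA subrr.
Qed.

(* The homogeneous coordinate of a, rescaled by lambda a. *)
Let x a := const (lambda a) * chi (partial_sum e (tau a)).

Let x_neq0 a : x a != 0.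
Proof. by rewrite mulf_neq0 ?chi_neq0 // const_neq0. Qed.

Let x_ratio a b : x a / x b = const (lambda a / lambda b) *
  chi (partial_sum e (tau a) - partial_sum e (tau b)).
Proof. by rewrite fmorph_div chiB /x mulf_div. Qed.

Let d_x_ratio a b q :
  d' a (x b / x q) = ((a == b)%:R - (a == q)%:R) * (x b / x q).
Proof.
rewrite d'E x_ratio d_monomial pairingB (pairing_partial_sum e_almost_simple) //.
by rewrite !rho_tau_eq rmorphB /= rmorphB /= !rmorph_nat.
Qed.

Let d'C a b f : d' a (d' b f) = d' b (d' a f).
Proof. by rewrite !d'E dC. Qed.

Let E := gl_der x d'.

Let E_neq0 b a : b != a -> E b a != 0.
Proof.
move=> _; have e_tau : pairing (rho (tau a)) (e (tau a)) = -1.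
  rewrite (almost_simple_pairing e_almost_simple rho_rays) // eqxx eq_sym.
  by rewrite (negPf (almost_simple_step e_almost_simple rho_rays _)) sub0r.
apply/eqP => /(congr1 (fun G : Der j => G (chi (e (tau a))))).
rewrite [X in X = _ -> _]/(x b / x a * d' a _) d'E d_char e_tau; apply/eqP.
rewrite !mulf_neq0 ?invr_eq0 ?x_neq0 ?chi_neq0 // const_neq0 //.
by rewrite rmorphN1 oppr_eq0 oner_eq0.
Qed.

Let D'_unit i : D' i = gl_map E (c i *: delta_mx (sigma (ordS i)) (sigma i)).
Proof.
rewrite gl_mapZ gl_map_delta; apply: der_ext => f.
rewrite derZ [X in _ = _ * X](_ : _ =
  x (sigma (ordS i)) / x (sigma i) * d' (sigma i) f) //.
rewrite d'E D'E x_ratio.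
rewrite -(@root_partial_sum _ _ _ _ _ e_almost_simple rho_rays i) //.
have -> : D i = der_mull (const (phi i) * chi (e i)) (d (sigma i)).
  apply: chi_ext => u; rewrite D_root der_mullE d_char rho_tau rmorphM.
  by rewrite [u + _]addrC chiD mulrACA.
by rewrite der_mullE j_const phiE rmorphM !mulrA.
Qed.

(** The generators are the images of multiples [c i] of the units of the edges, under
    a map that respects brackets and is injective on the algebra [sl] which these
    units generate. *)
Theorem lie_generated_closed_walk :
  lie_isomorphic (lie_generated (range D')) (sl F r).
Proof.
have E_bracket := gl_der_bracket x_neq0 d_x_ratio d'C.
have -> : range D' = gl_map E @`
    range (fun i => c i *: delta_mx (sigma (ordS i)) (sigma i)).
  by rewrite image_comp; apply: eq_imagel => i _; exact: D'_unit.
rewrite (lie_generated_image (gl_map_linear E) (gl_map_bracket E_bracket)).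
rewrite lie_generated_walk => [|a|i|i].
- apply: (lie_isomorphic_image (gl_map_linear E) (gl_map_bracket E_bracket)).
    exact: sl_subalgebra.
  exact: (gl_map_sl_inj E_bracket char0 E_neq0).
- by exists (tau a).
- apply/eqP => /sigmaP/eqP; apply/negP.
  exact: (almost_simple_step e_almost_simple rho_rays).
- apply: contraNneq (phi_neq0 i) => ci.
  by rewrite phiE ci rmorph0 mul0r.
Qed.

End LieAlgebraOfClosedWalk.

(** * Coefficients of simple families *)

(** A zero derivation is proportional to any other, and there is another one. *)
Lemma root_derivation_coef_neq0 (K : fieldType) (n m : nat) (phi : 'I_m -> K)
    (rho : 'I_m -> 'cV[int]_n) (e : 'I_m -> 'rV[int]_n)
    (D : 'I_m -> Der (rf_const K n)) :
  (1 < m)%N -> (forall i, is_root_derivation (phi i) (rho i) (e i) (D i)) ->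
  (forall i l, i != l -> ~ proportional (D i) (D l)) -> forall i, phi i != 0.
Proof.
move=> hm hD hprop i; apply/eqP => phi0.
have Di0 : D i = 0.
  by apply: der_rf_char_ext => u; rewrite hD phi0 mul0r rmorph0 mul0r.
have [l il] : exists l, i != l.
  have i_lt : ((i == 0 :> nat) < m)%N by case: (_ == _) => //; exact: ltnW.
  by exists (Ordinal i_lt); rewrite -val_eqE /=; case: (val i).
by apply: (hprop i l il); exists 0; left; rewrite scale0r Di0.
Qed.

Lemma codom_classes (T : eqType) (m r : nat) (f : 'I_m -> T) :
  r = size (undup (codom f)) -> exists sigma : 'I_m -> 'I_r,
    (forall i l, sigma i = sigma l <-> f i = f l) /\
    (forall a, exists i, sigma i = a).
Proof.
move=> ->; set U := undup _.
have fU i : f i \in U by rewrite mem_undup codom_f.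
have lt_index i : (index (f i) U < size U)%N by rewrite index_mem.
exists (fun i => Ordinal (lt_index i)); split=> [i l|a].
  split=> [[il]|il]; last by apply: val_inj; rewrite /= il.
  by rewrite -(nth_index (f i) (fU i)) il nth_index.
have [i aE] : exists i, f i = tnth (in_tuple U) a.
  have /codomP[i ->] : tnth (in_tuple U) a \in codom f by rewrite -mem_undup mem_tnth.
  by exists i.
exists i; apply: val_inj; rewrite /= aE (tnth_nth (f i)) /= index_uniq //.
exact: undup_uniq.
Qed.

Lemma prod_same_range (K : fieldType) (m p q : nat) (phi : 'I_m -> K)
    (s : 'I_p -> 'I_m) (t : 'I_q -> 'I_m) :
  injective s -> injective t -> range s = range t ->
  \prod_i phi (s i) = \prod_i phi (t i).
Proof.
move=> s_inj t_inj st.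
have prodE l (u : 'I_l -> 'I_m) : \prod_i phi (u i) = \prod_(x <- codom u) phi x.
  by rewrite /codom /image_mem big_map big_enum.
rewrite !prodE; apply/perm_big/uniq_perm.
- by rewrite map_inj_uniq ?enum_uniq.
- by rewrite map_inj_uniq ?enum_uniq.
have sub l l' (u : 'I_l -> 'I_m) (u' : 'I_l' -> 'I_m) : range u `<=` range u' ->
    {subset codom u <= codom u'}.
  move=> uu' _ /codomP[i ->]; have [|b _ <-] := uu' (u i); first by exists i.
  exact: codom_f.
by move=> x; apply/idP/idP; apply: sub; rewrite st.
Qed.

Section VerySimple.
Variables (k K : fieldType) (incl : {rmorphism k -> K}).
Variables (n m : nat) (Sigma : set (set 'cV[rat]_n)) (phi : 'I_m -> K).
Variables (rho : 'I_m -> 'cV[int]_n) (e : 'I_m -> 'rV[int]_n).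
Hypothesis rho_rays : forall i, rays Sigma (rho i).
Hypothesis phi_neq0 : forall i, phi i != 0.
Hypothesis cyclic_simple :
  forall A, cyclic_set rho e A -> simple_set Sigma incl phi rho e A.
Variables (p : nat) (s : 'I_p -> 'I_m).
Hypothesis s_inj : injective s.
Hypothesis s_simple :
  simple_family Sigma (rho \o s) (e \o s) incl (phi \o s).

Let is_const z := exists c : k, z = incl c.

Let is_constM z t : is_const z -> is_const t -> is_const (z * t).
Proof. by case=> c -> [d ->]; exists (c * d); rewrite rmorphM. Qed.

Let is_constV z : is_const z -> is_const z^-1.
Proof. by case=> c ->; exists c^-1; rewrite fmorphV. Qed.

Let srays i : rays Sigma ((rho \o s) i). Proof. exact: rho_rays. Qed.

Let step i : rho (s (ordS i)) != rho (s i).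
Proof. exact: (almost_simple_step s_simple.1 srays). Qed.

Let step_pairing i : pairing (rho (s (ordS i))) (e (s i)) = 1.
Proof.
have := almost_simple_pairing s_simple.1 srays i (rho_rays (s (ordS i))).
by rewrite /= eqxx (negPf (step i)) subr0.
Qed.

Definition partial_prod (i : nat) : K := \prod_(l < p | (l < i)%N) phi (s l).

Lemma partial_prod_neq0 i : partial_prod i != 0.
Proof. by apply/prodf_neq0 => l _. Qed.

Lemma partial_prodS (i : 'I_p) :
  partial_prod i.+1 = partial_prod i * phi (s i).
Proof.
rewrite /partial_prod (bigD1 i) /= ?ltnSn // mulrC; congr (_ * _).
by apply: eq_bigl => q; rewrite -val_eqE /= ltnS ltn_neqAle andbC.
Qed.

Let partial_prodD i q (h : forall t : 'I_q, (i + t < p)%N) :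
  partial_prod (i + q) = partial_prod i * \prod_(t < q) phi (s (Ordinal (h t))).
Proof.
elim: q h => [|q IH] h; first by rewrite addn0 big_ord0 mulr1.
have hq (t : 'I_q) : (i + t < p)%N by exact: (h (widen_ord (leqnSn q) t)).
rewrite big_ord_recr /= mulrA addnS (partial_prodS (Ordinal (h ord_max))) /= (IH hq).
congr (_ * _ * _); apply: eq_bigr => t _.
by congr (phi (s _)); exact: val_inj.
Qed.

Let ordSE (i : 'I_p) (lt_iS : (i.+1 < p)%N) : ordS i = Ordinal lt_iS.
Proof. by apply: val_inj; rewrite /= modn_small. Qed.

(** Between two visits of the same ray the derivations of the walk form a cyclic
    set, closed up by the equality of the two rays.  It has at least two elements
    since consecutive rays differ.  The order in which it is simple may be another
    one, which does not affect the product. *)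
Lemma closed_segment_prod (i l : 'I_p) : (i < l)%N -> rho (s i) = rho (s l) ->
  exists c : k, partial_prod l / partial_prod i = incl c.
Proof.
move=> il rho_il; pose q := (l - i)%N.
have h (t : 'I_q) : (i + t < p)%N.
  by rewrite (leq_trans _ (ltn_ord l)) // ltnS ltnW // -ltn_subRL.
pose u (t : 'I_q) := s (Ordinal (h t)).
have u_inj : injective u.
  by move=> t t' /s_inj[] /addnI tt'; exact: val_inj.
have q_gt1 : (1 < q)%N.
  rewrite ltn_subRL addn1 ltn_neqAle il andbT; apply/eqP => iSl.
  have lt_iS : (i.+1 < p)%N by rewrite iSl.
  have := step i; rewrite ordSE rho_il.
  by have -> : Ordinal lt_iS = l; [exact: val_inj|rewrite eqxx].
have [q' [t [[_ t_inj tu]]]] : simple_set Sigma incl phi rho e (range u).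
  apply: cyclic_simple; exists q, u; split=> // t.
  have [lt_tS|ge_tS] := boolP (t.+1 < q)%N.
    rewrite /= /u; have -> : Ordinal (h (ordS t)) = ordS (Ordinal (h t)).
      apply: val_inj; rewrite /= modn_small // modn_small ?addnS //.
      by rewrite -addnS; exact: (h (Ordinal lt_tS)).
    by rewrite step_pairing.
  have tq : t.+1 = q by apply/eqP; rewrite eqn_leq ltn_ord leqNgt.
  have itl : (i + t).+1 = l by rewrite -addnS tq /q subnKC // ltnW.
  rewrite /= /u; have -> : Ordinal (h (ordS t)) = i.
    by apply: val_inj; rewrite /= tq modnn addn0.
  rewrite rho_il; have -> : l = ordS (Ordinal (h t)).
    by apply: val_inj; rewrite /= itl modn_small.
  by rewrite step_pairing.
case=> _ [c prodE]; exists c; rewrite -prodE /= (prod_same_range phi t_inj u_inj tu).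
have -> : partial_prod l = partial_prod (i + q) by rewrite subnKC // ltnW.
rewrite (partial_prodD h) mulrAC divff ?mul1r //.
exact: partial_prod_neq0.
Qed.

Let potential_ratio (i l : 'I_p) : rho (s i) = rho (s l) ->
  is_const (partial_prod l / partial_prod i).
Proof.
move=> il; have [lt|lt|eq] := ltngtP i l.
- exact: closed_segment_prod.
- by rewrite -invf_div; apply: is_constV; exact: closed_segment_prod.
- by exists 1; rewrite eq divff ?partial_prod_neq0 // rmorph1.
Qed.

(* At the last index the partial products start again from 1, and the ratio is the
   product over the whole family. *)
Let step_ratio (i : 'I_p) :
  is_const (phi (s i) * (partial_prod i / partial_prod (ordS i))).
Proof.
have [lt_iS|ge_iS] := boolP (i.+1 < p)%N.
  exists 1; rewrite (ordSE lt_iS) /= partial_prodS rmorph1.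
  by rewrite mulrA [phi _ * _]mulrC divff // mulf_neq0 ?partial_prod_neq0.
have iSp : i.+1 = p by apply/eqP; rewrite eqn_leq ltn_ord leqNgt.
have [_ [c prodE]] := s_simple; exists c; rewrite -prodE.
have -> : partial_prod (ordS i) = 1.
  by rewrite /= iSp modnn /partial_prod big_pred0.
rewrite divr1 mulrC -partial_prodS iSp /partial_prod.
by apply: eq_bigl => l; rewrite ltn_ord.
Qed.

(** The potential at a vertex is the partial product at a chosen visit of it; another
    visit would change it by a constant factor only. *)
Lemma very_simple_coboundary (r : nat) (sigma : 'I_p -> 'I_r) (tau : 'I_r -> 'I_p) :
  (forall i, rho (s (tau (sigma i))) = rho (s i)) ->
  exists (lambda : 'I_r -> K) (c : 'I_p -> k),
    (forall a, lambda a != 0) /\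
    forall i, phi (s i) = incl (c i) * (lambda (sigma (ordS i)) / lambda (sigma i)).
Proof.
move=> rho_tau; pose lambda a := partial_prod (tau a).
have l0 a : lambda a != 0 by exact: partial_prod_neq0.
have /choice[c cE] i :
    is_const (phi (s i) * (lambda (sigma i) / lambda (sigma (ordS i)))).
  have -> : phi (s i) * (lambda (sigma i) / lambda (sigma (ordS i))) =
    phi (s i) * (partial_prod i / partial_prod (ordS i)) *
    (lambda (sigma i) / partial_prod i) *
    (partial_prod (ordS i) / lambda (sigma (ordS i))).
    by field; rewrite !partial_prod_neq0.
  apply: is_constM; first apply: is_constM; first exact: step_ratio.
  - by apply: potential_ratio; rewrite rho_tau.
  - by apply: potential_ratio; rewrite rho_tau.
exists lambda, c; split=> // i.
by rewrite -cE; field; rewrite !l0.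
Qed.

End VerySimple.

(** * Lie algebras of almost simple and very simple sets *)

Theorem proposition4p4
    (k : closedFieldType) (char0 : [pchar k] =i pred0)
    (s : nat) (Y : set ('I_s -> k)) (hY : affine_variety Y)
    (K0 : fieldType) (incl : {rmorphism k -> K0}) (hK0 : is_function_field Y incl)
    (n : nat) (Sigma : set (set 'cV[rat]_n)) (hSigma : is_fan Sigma)
    (hspan : rays_span Sigma)
    (m : nat) (hm : (1 < m)%N)
    (phi : 'I_m -> K0) (rho : 'I_m -> 'cV[int]_n) (e : 'I_m -> 'rV[int]_n)
    (he : forall i, demazure_root Sigma (rho i) (e i))
    (D : 'I_m -> Der (rf_const K0 n))
    (hD : forall i, is_root_derivation (phi i) (rho i) (e i) (D i))
    (hprop : forall i j, i != j -> ~ proportional (D i) (D j))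
    (r : nat) (hr : r = size (undup (codom rho))) :
  (almost_simple Sigma rho e ->
     lie_isomorphic (lie_generated (range D)) (sl K0 r))
  /\
  (very_simple Sigma incl phi rho e ->
     lie_isomorphic (lie_generated (range (fun i => der_restr incl (D i))))
                    (sl k r)).
Proof.
have phi_neq0 := root_derivation_coef_neq0 hm hD hprop.
have rho_rays i : rays Sigma (rho i) by have [] := he i.
have [sigma [sigmaP sigma_surj]] := codom_classes hr.
have listing_tau p (t : 'I_p -> 'I_m) : range t = [set: 'I_m] ->
    exists tau : 'I_r -> 'I_p, cancel tau (sigma \o t).
  move=> t_range; suff /choice[tau tauK] a : exists l, sigma (t l) = a.
    by exists tau.
  have [i <-] := sigma_surj a; have : [set: 'I_m] i by [].
  by rewrite -t_range => -[l _ <-]; exists l.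
have range_listing (T : Type) (G : 'I_m -> T) p (t : 'I_p -> 'I_m) :
    range t = [set: 'I_m] -> range G = range (G \o t).
  move=> t_range; apply/seteqP; split=> [_ [i _ <-]|_ [l _ <-]]; last by exists (t l).
  have : [set: 'I_m] i by [].
  by rewrite -t_range => -[l _ <-]; exists l.
have chi0 := rf_char0 K0 n; have chiD := @rf_charD K0 n.
have chi_ext := @der_rf_char_ext K0 n.
split.
- case=> p [t [[_ _ t_range] t_as]]; have [tau tauK] := listing_tau p t t_range.
  rewrite (range_listing _ D _ _ t_range).
  apply: (@lie_generated_closed_walk K0 K0 _ idfun n (rf_const K0 n) (@rf_char K0 n)
    chi0 chiD chi_ext (rf_const K0 n) _ _ p Sigma hspan
    (phi \o t) (rho \o t) (e \o t) _ t_as _ (D \o t) (D \o t) _ _ r (sigma \o t) tau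
    _ tauK (fun=> 1) (phi \o t)).
  + move=> c; reflexivity.
  + by move=> q; rewrite (fmorph_pchar incl); exact: char0.
  + by move=> i; exact: rho_rays.
  + by move=> i; exact: phi_neq0.
  + by move=> i u; exact: hD.
  + move=> i x; reflexivity.
  + by move=> i l; exact: sigmaP.
  + by move=> a; exact: oner_neq0.
  + by move=> i; rewrite divr1 mulr1.
- case=> -[p [t [[_ t_inj t_range] t_simple]]] cyclic_simple.
  have [tau tauK] := listing_tau p t t_range.
  rewrite (range_listing _ (fun i => der_restr incl (D i)) _ _ t_range).
  have rho_tau i : rho (t (tau ((sigma \o t) i))) = rho (t i).
    by apply/sigmaP; exact: (tauK (sigma (t i))).
  have [lambda [c [l0 phiE]]] :=
    very_simple_coboundary rho_rays phi_neq0 cyclic_simple t_inj t_simple rho_tau.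
  apply: (@lie_generated_closed_walk k K0 _ incl n (rf_const K0 n) (@rf_char K0 n)
    chi0 chiD chi_ext (rf_const K0 n \o incl) _ char0 p Sigma
    hspan (phi \o t) (rho \o t) (e \o t) _ t_simple.1 _ (D \o t) _ _ _ r (sigma \o t)
    tau _ tauK lambda c l0 phiE).
  + move=> z; reflexivity.
  + by move=> i; exact: rho_rays.
  + by move=> i; exact: phi_neq0.
  + by move=> i u; exact: hD.
  + move=> i x; reflexivity.
  + by move=> i l; exact: sigmaP.
Qed.
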